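(* Let $X$ be a vector space over $\mathbb{R}$ or $\mathbb{C}$, let $\rho : X \to [0,+\infty]$ be a modular satisfying the $\Delta_2$-condition, and let $X_\rho$ be the associated modular space. Then $X_\rho$, endowed with the topology $\tau$ determined by the balls $B_\rho(0,r)$, $r>0$ (see context), is a Hausdorff topological vector space.
   Context: A modular on a vector space $X$ over $\mathbb{R}$ or $\mathbb{C}$ is a map $\rho : X \to [0,+\infty]$ such that for all $x,y \in X$: (i) $\rho(x) = 0$ if and only if $x = 0$; (ii) $\rho(-x) = \rho(x)$ in the real case, and $\rho(e^{it}x) = \rho(x)$ for all $t \in \mathbb{R}$ in the complex case; (iii) $\rho(\alpha x + \beta y) \le \rho(x) + \rho(y)$ whenever $\alpha, \beta \ge 0$ and $\alpha + \beta = 1$. The associated modular space is $X_\rho = \{x \in X : \rho(\lambda x) \to 0 \text{ as } \lambda \to 0\}$, a vector subspace of $X$. $\Delta_2$-condition: for every sequence $(x_n)_{n \in \mathbb{N}}$ in $X_\rho$, if $\lim_{n\to\infty} \rho(x_n) = 0$ then $\lim_{n\to\infty} \rho(2x_n) = 0$. Topology: for $r > 0$ let $B_\rho(0,r) = \{x \in X_\rho : \rho(x) < r\}$ and let $\mathcal{B} = \{B_\rho(0,r) : r > 0\}$. The topology $\tau$ on $X_\rho$ is $\tau = \{G \subset X_\rho : \text{for every } x \in G \text{ there exists } V \in \mathcal{B} \text{ with } x + V \subset G\}$ (it contains $\emptyset$). *)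

(* Defs.v *)
From HB Require Import structures.
From mathcomp Require Import all_boot all_order all_algebra.
From mathcomp Require Import all_classical all_reals all_analysis.
From mathcomp Require Import complex.

Set Implicit Arguments.
Unset Strict Implicit.
Unset Printing Implicit Defensive.

Import Order.TTheory GRing.Theory Num.Theory.
Import numFieldNormedType.Exports.

Local Open Scope classical_set_scope.
Local Open Scope ring_scope.
Local Open Scope complex_scope.

(* [S] is the set of scalars under which the modular is invariant: {-1} over
   the reals, {e^{it} | t real} over the complex numbers; see [real_modular]
   and [complex_modular] below.  When K is R[i], [0 <= a] says that a is a
   nonnegative real number. *)
Record modular (R : realType) (K : numFieldType) (S : set K)
    (X : lmodType K) := Modular {
  modular_fun :> X -> \bar R ;
  modular_ge0 : forall x, (0 <= modular_fun x)%E ;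
  modular_eq0 : forall x, modular_fun x = 0%E <-> x = 0 ;
  modular_sym : forall (u : K) x, S u -> modular_fun (u *: x) = modular_fun x ;
  modular_convex : forall (a b : K) x y, 0 <= a -> 0 <= b -> a + b = 1 ->
    (modular_fun (a *: x + b *: y) <= modular_fun x + modular_fun y)%E }.

Definition real_modular (R : realType) (X : lmodType R) :=
  modular R [set -1 : R] X.

Definition expi (R : realType) (t : R) : R[i] := cos t +i* sin t.

Definition complex_modular (R : realType) (X : lmodType R[i]) :=
  modular R (range (@expi R)) X.

Section ModularSpace.
Context {R : realType} {K : numFieldType} {S : set K} {X : lmodType K}.
Variable rho : modular R S X.

Definition modular_set : set X :=
  [set x | rho (l *: x) @[l --> (0 : K)^'] --> 0%E].

Definition modular_pred : {pred X} := fun x => x \in modular_set.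

Let rho0 : rho 0 = 0%E. Proof. exact/modular_eq0. Qed.

Let modular_cvgE (x : X) :
  x \in modular_pred <-> rho (l *: x) @[l --> (0 : K)] --> 0%E.
Proof.
have -> : (x \in modular_pred) = (x \in modular_set) by [].
rewrite inE; split=> h A A0.
  have hA : \forall l \near (0 : K), l != 0 -> A (rho (l *: x)) by exact: h.
  change (\forall l \near (0 : K), A (rho (l *: x))).
  apply: filterS hA => l hl; have [->|/hl//] := eqVneq l 0.
  by rewrite scale0r rho0; exact: nbhs_singleton.
change (\forall l \near (0 : K), l != 0 -> A (rho (l *: x))).
have hA : \forall l \near (0 : K), A (rho (l *: x)) by exact: h.
by apply: filterS hA.
Qed.

Lemma modular_submod_closed : submod_closed modular_pred.
Proof.
have scale a x : x \in modular_pred -> a *: x \in modular_pred.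
  move=> /modular_cvgE hx; apply/modular_cvgE.
  under eq_fun do rewrite scalerA.
  apply: (@cvg_comp _ _ _ (fun l : K => l * a) (fun l => rho (l *: x)) _ _ _ _ hx).
  have /= := @cvgMr_tmp K K (nbhs (0 : K)) _ id 0 a cvg_id.
  by rewrite mul0r; apply.
split=> [|a x y hx hy].
  apply/modular_cvgE; under eq_fun do rewrite scaler0 rho0.
  by move=> A A0; apply: (@cvg_cst _ (0%E : \bar R) _ (nbhs (0 : K))).
have /modular_cvgE h1 := scale 2 _ (scale a _ hx).
have /modular_cvgE h2 := scale 2 _ hy.
apply/modular_cvgE.
apply: (@squeeze_cvge K (nbhs (0 : K)) _ R (cst 0%E) _
  (fun l => rho (l *: (2 *: (a *: x))) + rho (l *: (2 *: y)))%E).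
- apply: nearW => l; rewrite modular_ge0 /=.
  have half (z : X) : l *: z = 2^-1 *: (l *: (2 *: z)).
    by rewrite !scalerA mulrAC mulVf ?pnatr_eq0// mul1r.
  rewrite scalerDr (half (a *: x)) (half y); apply: modular_convex.
  + by rewrite invr_ge0 ler0n.
  + by rewrite invr_ge0 ler0n.
  + by rewrite -[2^-1]mul1r -splitr.
- exact: cvg_cst.
- by have := cvgeD _ h1 h2; rewrite adde0; exact.
Qed.

HB.instance Definition _ :=
  GRing.isSubmodClosed.Build K X modular_pred modular_submod_closed.

Record modular_space := ModularSpace {
  modular_val :> X ; _ : modular_val \in modular_pred }.

HB.instance Definition _ := [isSub for modular_val].
HB.instance Definition _ := [Choice of modular_space by <:].
HB.instance Definition _ :=
  [SubChoice_isSubLmodule of modular_space by <:].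

Definition modular_ball (r : R) : set modular_space :=
  [set x : modular_space | (rho x < r%:E)%E].

Definition modular_open (G : set modular_space) : Prop :=
  forall x, G x ->
    exists2 r : R, 0 < r & [set x + v | v in modular_ball r] `<=` G.

Let modular_openT : modular_open setT.
Proof. by move=> x _; exists 1. Qed.

Let modular_openI (A B : set modular_space) :
  modular_open A -> modular_open B -> modular_open (A `&` B).
Proof.
move=> oA oB x [/oA[r r0 rA] /oB[s s0 sB]].
exists (Num.min r s); first by rewrite lt_min r0.
move=> _ [v vrs <-]; split; [apply: rA|apply: sB]; exists v => //;
  by rewrite /modular_ball/=; apply: lt_le_trans vrs _;
     rewrite lee_fin ge_min lexx ?orbT.
Qed.

Let modular_open_bigU (I : Type) (F : I -> set modular_space) :
  (forall i, modular_open (F i)) -> modular_open (\bigcup_i F i).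
Proof.
move=> oF x [i _ /oF[r r0 rF]]; exists r => // y /rF Fy; by exists i.
Qed.

HB.instance Definition _ := isOpenTopological.Build modular_space
  modular_openT modular_openI modular_open_bigU.

Lemma modular_openE : @open modular_space = modular_open.
Proof. by []. Qed.

Definition Delta2 : Prop := forall x : nat -> modular_space,
  rho (x n) @[n --> \oo] --> 0%E -> rho (2 *: x n) @[n --> \oo] --> 0%E.

End ModularSpace.

(* Continuity of the opposite, also part of [topologicalLmodType], follows from
   that of scaling. *)
Definition hausdorff_tvs (K : numFieldType) (E : preTopologicalLmodType K) :=
  [/\ continuous (fun z : E * E => z.1 + z.2),
      continuous (fun z : K^o * E => z.1 *: z.2) &
      hausdorff_space E].

(* Main.v *)
(** Delta_2 upgrades to: for every e > 0 there is d > 0 such that rho x < d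
    implies rho (2 x) < e.  Combined with
    rho (x + y) <= rho (2 x) + rho (2 y), this gives, for each e, a d with
    B(0,d) + B(0,d) included in B(0,e); hence the translated balls x + B(0,r),
    which need not be open, form a neighbourhood basis at x, addition is
    continuous and points are separated.  Scaling is continuous since
    l (x + v) = a x + ((l - a) x + (a v + (l - a) v)): the term (l - a) x is
    small because x lies in the modular space, a v by iterating the Delta_2
    bound n times with |a| <= 2^n, and (l - a) v because rho does not increase
    under scalars of modulus at most 1. *)

Require Import Defs.
From mathcomp Require Import all_boot all_order all_algebra.
From mathcomp Require Import all_classical all_reals all_analysis.
From mathcomp Require Import complex.

Local Open Scope complex_scope.

Import Order.TTheory GRing.Theory Num.Theory.
Import numFieldNormedType.Exports.
Local Open Scope classical_set_scope.
Local Open Scope ring_scope.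

Lemma nbhs0_ereal_lt (R : realType) (e : R) : 0 < e ->
  nbhs (0%E : \bar R) [set y | (y < e%:E)%E].
Proof.
move=> e0; apply: open_nbhs_nbhs; split; last by rewrite /= lte_fin.
exact: open_ereal_lt_ereal.
Qed.

(** * Modulars with the Delta_2-condition over a general scalar field *)

Section DeltaTwoModular.
Context (R : realType) (K : numFieldType) (S : set K) (X : lmodType K).
Variable rho : modular R S X.
(** These two hypotheses are how the real and the complex case enter: symmetry becomes dependence on
    the modulus of the scalar only, and [K_archi] bounds the number of doublings. *)
Hypothesis rho_norm : forall (a : K) x, rho (a *: x) = rho (`|a| *: x).
Hypothesis K_archi : forall a : K, exists n, `|a| <= 2 ^+ n.
Hypothesis rho_Delta2 : Delta2 rho.

Local Notation E := (modular_space rho).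

Lemma modular0 : rho 0 = 0%E. Proof. exact/modular_eq0. Qed.

Lemma modularN (x : X) : rho (- x) = rho x.
Proof. by rewrite -scaleN1r rho_norm normrN1 scale1r. Qed.

(** After replacing a by |a|, the vector |a| x is the convex combination |a| x + (1 - |a|) 0, and
    rho 0 = 0. *)
Lemma modular_scale_le (a : K) x : `|a| <= 1 -> (rho (a *: x) <= rho x)%E.
Proof.
move=> a1; rewrite rho_norm -[X in rho X]addr0.
rewrite -[in X in rho X](scaler0 _ (1 - `|a|)).
apply: le_trans (modular_convex rho x 0 (normr_ge0 _) _ _) _.
- by rewrite subr_ge0.
- by rewrite addrC subrK.
- by rewrite modular0 adde0.
Qed.

Lemma modular_add_le (x y : X) :
  (rho (x + y)%R <= rho (2 *: x) + rho (2 *: y))%E.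
Proof.
have half (z : X) : z = 2^-1 *: (2 *: z).
  by rewrite scalerA mulVf ?pnatr_eq0// scale1r.
rewrite {1}(half x) {1}(half y); apply: modular_convex.
- by rewrite invr_ge0 ler0n.
- by rewrite invr_ge0 ler0n.
- by rewrite -[2^-1]mul1r -splitr.
Qed.

Lemma modular_double_small (e : R) : 0 < e -> exists2 d : R, 0 < d &
  forall x : E, (rho x < d%:E)%E -> (rho (2 *: x) < e%:E)%E.
Proof.
move=> e0; apply: contrapT => H.
(* If no d works, each d = 1/(n+1) has a counterexample; the chosen sequence contradicts Delta_2. *)
have /choice[x xP] (n : nat) : exists x : E,
    (rho x < n.+1%:R^-1%:E)%E /\ (e%:E <= rho (2 *: x))%E.
  apply: contrapT => Hn; apply: H; exists n.+1%:R^-1; first by rewrite invr_gt0.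
  move=> x xn; rewrite ltNge; apply/negP => ex; by apply: Hn; exists x.
have x0 : rho (x n) @[n --> \oo] --> 0%E.
  apply: (@squeeze_cvge _ _ _ R (cst 0%E) _ (fun n => (n.+1%:R^-1)%:E)).
  - by apply: nearW => n; rewrite modular_ge0 ltW// (xP n).1.
  - exact: cvg_cst.
  - by apply: cvg_EFin; [exact: nearW|exact: cvg_harmonic].
have /(_ [set y | (y < e%:E)%E]) := rho_Delta2 _ x0.
case; first exact: nbhs0_ereal_lt.
move=> N _ /(_ N (leqnn N))/=; by rewrite ltNge (xP N).2.
Qed.

Lemma modular_add_small (e : R) : 0 < e -> exists2 d : R, 0 < d &
  forall x y : E, (rho x < d%:E)%E -> (rho y < d%:E)%E ->
    (rho (x + y)%R < e%:E)%E.
Proof.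
move=> e0; have [d d0 dP] := modular_double_small _ (divr_gt0 e0 (ltr0n _ 2)).
exists d => // x y xd yd; apply: le_lt_trans (modular_add_le _ _) _.
by rewrite (splitr e) EFinD lteD// dP.
Qed.

Lemma modular_scale_small (a : K) (e : R) : 0 < e -> exists2 d : R, 0 < d &
  forall x : E, (rho x < d%:E)%E -> (rho (a *: x) < e%:E)%E.
Proof.
have [n an] := K_archi a; elim: n a an e => [|n IH] a an e e0.
  by exists e => // x; apply: le_lt_trans; apply: modular_scale_le.
have [d d0 dP] := modular_double_small _ e0.
(* Write a x = 2 ((a/2) x): the induction hypothesis handles a/2, and d absorbs the last
   doubling. *)
have a2 : `|2^-1 * a| <= 2 ^+ n.
  by rewrite normrM ger0_norm ?invr_ge0// ler_pdivrMl// -exprS.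
have [c c0 cP] := IH _ a2 _ d0.
exists c => // x /cP /(dP (_ *: x)).
by rewrite /= scalerA mulrA divff ?pnatr_eq0// mul1r.
Qed.

Lemma modular_nbhsP (x : E) (A : set E) : nbhs x A <->
  exists2 r : R, 0 < r & forall v : E, (rho v < r%:E)%E -> A (x + v).
Proof.
split.
  rewrite nbhsE => -[B [oB Bx] BA].
  have : modular_open B by rewrite -modular_openE.
  move=> /(_ _ Bx)[r r0 rB]; exists r => // v vr.
  by apply/BA/rB; exists v.
move=> [r r0 rA].
(* The open witness is the interior of A in terms of balls: the points having some translated ball
   inside A. It is open because, if radius s works at y, then d works at every y + v with rho v <
   d. *)
rewrite nbhsE; exists [set y : E | exists2 r : R, 0 < r &
  forall v : E, (rho v < r%:E)%E -> A (y + v)]; last first.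
  by move=> y [s s0 /(_ 0)]; rewrite addr0; apply; rewrite /= modular0 lte_fin.
split; last by exists r.
rewrite modular_openE => y [s s0 sA].
have [d d0 dP] := modular_add_small _ s0.
exists d => // _ [v vd <-]; exists d => // w wd.
by rewrite -addrA; apply/sA/dP.
Qed.

Lemma modular_add_continuous : continuous (fun z : E * E => z.1 + z.2).
Proof.
move=> [x y] A /modular_nbhsP[r r0 rA].
have [d d0 dP] := modular_add_small _ r0.
have dnbhs (z : E) : nbhs z [set z + v | v in modular_ball d].
  by apply/modular_nbhsP; exists d => // v vd; exists v.
exists ([set x + v | v in modular_ball d], [set y + v | v in modular_ball d]).
  by split; exact: dnbhs.
move=> [_ _] [/= [v vd <-] [w wd <-]].
by rewrite addrACA; apply/rA/dP.
Qed.

Lemma modular_scale_continuous : continuous (fun z : K^o * E => z.1 *: z.2).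
Proof.
move=> [a x] A /modular_nbhsP[r r0 rA].
have [d d0 dP] := modular_add_small _ r0.
have [c c0 cP] := modular_add_small _ d0.
have [b b0 bP] := modular_scale_small a _ c0.
have scale_near : nbhs (0 : K) [set l : K | (rho (l *: \val x) < d%:E)%E].
  have : modular_set rho (\val x) by rewrite -inE; exact: (valP x).
  move=> /(_ [set y | (y < d%:E)%E])[]; first exact: nbhs0_ereal_lt.
  move=> s /= s0 sP; exists s => // l /sP/=.
  (* The limit defining [modular_set] ignores l = 0, where the value is rho 0 = 0. *)
  by have [->|l0 /(_ isT)//] := eqVneq l 0; rewrite scale0r modular0 lte_fin.
have a_near : nbhs (a : K^o) [set l : K |
    (rho ((l - a) *: \val x) < d%:E)%E /\ `|l - a| <= 1].
  have h : (l - a) @[l --> (a : K)] --> (0 : K).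
    rewrite -(subrr a).
    exact: (@cvgB K K^o K (nbhs a) _ id (cst a) a a cvg_id (cvg_cst _)).
  apply: filterI; first exact: (h _ scale_near).
  apply: (h [set l | `|l| <= 1]).
  by exists 1 => //= l; rewrite /ball/= sub0r normrN => /ltW.
(* Radius b controls a v, radius c controls (l - a) v, hence the minimum. *)
exists ([set l : K | (rho ((l - a) *: \val x) < d%:E)%E /\ `|l - a| <= 1],
        [set x + v | v in modular_ball (Num.min b c)]).
  split; first exact: a_near.
  apply/modular_nbhsP; exists (Num.min b c); first by rewrite lt_min b0.
  by move=> v vd; exists v.
move=> [l _] [/= [lx l1] [v vbc <-]].
have -> : l *: (x + v) = a *: x + ((l - a) *: x + (a *: v + (l - a) *: v)).
  by rewrite -[in RHS]scalerDl addrA -scalerDl [a + _]addrC subrK scalerDr.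
have [vb vc] : (rho v < b%:E)%E /\ (rho v < c%:E)%E.
  by split; apply: lt_le_trans vbc _; rewrite lee_fin ge_min lexx ?orbT.
apply/rA/dP => //; apply: cP; first exact: bP.
by apply: le_lt_trans vc; exact: modular_scale_le.
Qed.

Lemma modular_hausdorff : hausdorff_space E.
Proof.
move=> x y xy; apply: contrapT => xNy.
(* As rho (x - y) may be infinite, a finite positive lower bound r is extracted, with 1 as the value
   in that case. *)
have [r r0 rP] : exists2 r : R, 0 < r & (r%:E <= rho (x - y)%R)%E.
  have : (0 < rho (x - y)%R)%E.
    rewrite lt_neqAle modular_ge0 andbT eq_sym; apply/eqP => /modular_eq0 h.
    by apply: xNy; apply/eqP; rewrite -subr_eq0; apply/eqP/val_inj.
  case: (rho _) => [s s0|_|//]; first by exists s.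
  by exists 1 => //; rewrite leey.
have [d d0 dP] := modular_add_small _ r0.
have dnbhs (z : E) : nbhs z [set z + v | v in modular_ball d].
  by apply/modular_nbhsP; exists d => // v vd; exists v.
have [_ [[v vd <-] [w wd wv]]] := xy _ _ (dnbhs x) (dnbhs y).
(* A common point x + v = y + w would force rho (x - y) < r. *)
have xyE : x - y = w - v by rewrite -[x](addrK v) -wv addrAC [y + w]addrC addrK.
move: rP; rewrite leNgt => /negP; apply.
rewrite -/(\val (x - y)%R) xyE; apply: dP => //.
by rewrite /= modularN.
Qed.

Lemma Delta2_hausdorff_tvs : hausdorff_tvs E.
Proof.
split; [exact: modular_add_continuous|exact: modular_scale_continuous|
        exact: modular_hausdorff].
Qed.

End DeltaTwoModular.

(** * The real and the complex scalars *)

Lemma natr_le_exp2 (K : numFieldType) (n : nat) : n%:R <= 2 ^+ n :> K.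
Proof. by rewrite -natrX ler_nat ltnW// ltn_expl. Qed.

Lemma real_archi (R : realType) (a : R) : exists n, `|a| <= 2 ^+ n.
Proof.
exists (Num.bound `|a|); apply: le_trans (natr_le_exp2 _ _).
exact/ltW/archi_boundP.
Qed.

Lemma complex_archi (R : realType) (a : R[i]) : exists n, `|a| <= 2 ^+ n.
Proof.
rewrite normc_def; set r := Num.sqrt _; have [n rn] := real_archi R r.
exists n; rewrite -[2 : R[i]](rmorph_nat (real_complex R)) -rmorphXn lecR.
exact: le_trans (ler_norm r) rn.
Qed.

Lemma cos_sin_surj (R : realType) (c s : R) : c ^+ 2 + s ^+ 2 = 1 ->
  exists t, cos t = c /\ sin t = s.
Proof.
move=> cs1.
have c1 : -1 <= c <= 1.
  rewrite -ler_norml -(ler_sqr _ _)// ?nnegrE//.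
  by rewrite real_normK ?num_real// expr1n -cs1 lerDl sqr_ge0.
have ss : Num.sqrt (1 - c ^+ 2) = `|s|.
  by rewrite -cs1 addrAC subrr add0r sqrtr_sqr.
(* [acos] takes values in [0, pi], where the sine is nonnegative; a negative s needs the opposite
   angle. *)
have [s0|s0] := leP 0 s.
  by exists (acos c); rewrite acosK ?sin_acos// ss ger0_norm.
by exists (- acos c); rewrite cosN sinN acosK ?sin_acos// ss ltr0_norm ?opprK.
Qed.

(** The polar form turns invariance under e^{it} into dependence on the modulus alone. *)
Lemma complex_polar (R : realType) (a : R[i]) : exists t, a = `|a| * expi t.
Proof.
have [->|a0] := eqVneq a 0; first by exists 0; rewrite normr0 mul0r.
case: a a0 => x y a0; rewrite normc_def /=.
set r := Num.sqrt _.
have r2 : r ^+ 2 = x ^+ 2 + y ^+ 2 by rewrite sqr_sqrtr// addr_ge0 ?sqr_ge0.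
have r0 : r != 0.
  rewrite sqrtr_eq0 -ltNge lt_neqAle addr_ge0 ?sqr_ge0// andbT eq_sym.
  rewrite paddr_eq0 ?sqr_ge0// !sqrf_eq0.
  by apply: contra a0 => /andP[/eqP-> /eqP->].
have [|t [ct st]] := @cos_sin_surj R (x / r) (y / r).
  by rewrite !expr_div_n -mulrDl -r2 divff ?sqrf_eq0.
exists t; rewrite /expi ct st; apply/eqP; rewrite eq_complex /=.
by rewrite !mul0r subr0 addr0 !(mulrC r) !divfK// !eqxx.
Qed.

Lemma real_modular_norm (R : realType) (X : lmodType R)
    (rho : real_modular X) (a : R) x : rho (a *: x) = rho (`|a| *: x).
Proof.
have [_|//] := ler0P a.
by rewrite -[- a]mulN1r -scalerA [RHS]modular_sym.
Qed.

Lemma complex_modular_norm (R : realType) (X : lmodType R[i])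
    (rho : complex_modular X) (a : R[i]) x : rho (a *: x) = rho (`|a| *: x).
Proof.
have [t {1}->] := complex_polar R a.
by rewrite mulrC -scalerA modular_sym//; exists t.
Qed.

Theorem mainTheorem2 (R : realType) :
  (forall (X : lmodType R) (rho : real_modular X),
     Delta2 rho -> hausdorff_tvs (modular_space rho)) /\
  (forall (X : lmodType R[i]) (rho : complex_modular X),
     Delta2 rho -> hausdorff_tvs (modular_space rho)).
Proof.
split=> X rho.
  apply: Delta2_hausdorff_tvs; [exact: real_modular_norm|exact: real_archi].
apply: Delta2_hausdorff_tvs; [exact: complex_modular_norm|exact: complex_archi].
Qed.
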